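(* There exists a positive constant $c$ such that for any given positive integers $\Delta, D$ with $\Delta>1$ satisfying $D\ge 16e^3\ln\Delta$, there exists an $n$-vertex graph $G$ with maximum degree $\le\Delta$, diameter $\le D$, and a vertex $s$ satisfying $$\Pr\{h(\mathcal{T}(G,s))\ge c\,(\Delta\ln n+\Delta D)\}\ge 1-o_n(1).$$
   Context: All graphs are finite, simple, undirected and connected. For a graph $G$ on $n$ vertices and $s\in V(G)$, build random subtrees $T_1,\dots,T_n$ of $G$: $T_1$ is the single vertex $s$, and for $1<i\le n$, $T_i$ is obtained from $T_{i-1}$ by choosing, uniformly at random, an edge of $G$ with exactly one endpoint in $T_{i-1}$ and adding it (with its other endpoint) to $T_{i-1}$. The random spanning tree $T_n$, rooted at $s$, is denoted $\mathcal{T}(G,s)$. The height $h(T)$ of a rooted tree $T$ is the maximum length (number of edges) of a root-to-leaf path. $\ln$ is the natural logarithm. The notation $o_k(1)$ denotes the set of functions $f:\mathbb{R}\to\mathbb{R}$ such that $f(k)\to0$ as $k\to\infty$. *)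

(* Defs.v *)
From HB Require Import structures.
From mathcomp Require Import all_boot all_order all_algebra reals.
Set Implicit Arguments.
Unset Strict Implicit.
Unset Printing Implicit Defensive.
Import Order.TTheory GRing.Theory Num.Theory.
Local Open Scope ring_scope.

Record graph := Graph {
  vertex :> finType;
  adj : rel vertex;
  adj_sym : symmetric adj;
  adj_irr : irreflexive adj;
  adj_conn : forall x y, connect adj x y }.

Section GraphParameters.
Variable G : graph.

Definition degree (x : G) : nat := #|[set y | adj x y]|.

Definition max_degree : nat := \max_(x : G) degree x.

Definition has_walk (k : nat) (x y : G) : bool :=
  [exists p : k.-tuple G, path (@adj G) x p && (last x p == y)].

(* The least k with a walk of length k from x to y; it is always found below
   #|G|, because G is connected. *)
Definition dist (x y : G) : nat :=
  find (fun k => has_walk k x y) (iota 0 #|G|).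

Definition diameter : nat := \max_(x : G) \max_(y : G) dist x y.

End GraphParameters.

Section RandomTree.
Variables (R : realType) (G : graph) (s : G).

(* A subtree rooted at s is represented by its set of edges, each edge written
   as a pair (parent, child); set0 is the one-vertex tree s. *)
Definition rtree := {set G * G}.

Definition tree_vertices (t : rtree) : {set G} := s |: [set a.2 | a in t].

(* The edges of G with exactly one endpoint in t. Each occurs once, as the pair
   (endpoint inside, endpoint outside). *)
Definition boundary (t : rtree) : {set G * G} :=
  [set a | [&& a.1 \in tree_vertices t, a.2 \notin tree_vertices t
             & adj a.1 a.2]].

Definition step_prob (t t' : rtree) : R :=
  #|[set a in boundary t | t' == a |: t]|%:R / #|boundary t|%:R.

(* tree_law i t is the probability that the tree obtained from s after adding
   i edges, i.e. the tree with i + 1 vertices, equals t. *)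
Fixpoint tree_law (i : nat) (t : rtree) : R :=
  if i is j.+1 then \sum_(u : rtree) tree_law j u * step_prob u t
  else (t == set0)%:R.

Definition spanning_tree_Pr (E : pred rtree) : R :=
  \sum_(t : rtree | E t) tree_law #|G|.-1 t.

Definition is_leaf (t : rtree) (x : G) : bool :=
  [forall y : G, (x, y) \notin t].

(* Edges point away from the root, so the paths below are the downward ones. *)
Definition height (t : rtree) : nat :=
  \max_(k < #|G| | [exists p : k.-tuple G,
     path (fun x y => (x, y) \in t) s p && is_leaf t (last s p)]) k.

End RandomTree.

(* Main.v *)
Require Import Defs.
From HB Require Import structures.
From mathcomp Require Import all_boot all_order all_algebra reals.
From mathcomp Require Import zify ring lra.
Import Order.TTheory GRing.Theory Num.Theory.
Set Implicit Arguments.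
Unset Strict Implicit.
Local Open Scope ring_scope.

(** Why the theorem holds.  The graph is a wheel with a thick rim cut open.  The
    rim, called the spine, consists of K * B layers of K vertices, consecutive
    layers being completely joined.  Every B layers a port vertex carries a
    spoke, a path of l = 6 * B vertices, and the K spokes meet in a hub.  Here
    K is of order Delta and B is about D / 14.  Degrees are at most 2 * K + 1,
    and at most 2 if K = 1.  Every vertex reaches the hub within l + B steps, so
    the diameter is at most 14 * B <= D.

    From the first layer the growth process runs along the spine K times faster
    than along a spoke: the foremost vertex reached in the spine has K boundary
    edges to the next layer, whereas each spoke offers a single boundary edge
    as long as the hub is not reached.  In the time that the growth needs for
    the K * B layers, a spoke is expected to gain about B vertices, far fewer
    than l.  Hence the last layer is very likely reached before the hub, and
    then the tree path to that layer stays in the spine and has at least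
    K * B - 1 edges, which is of order Delta * D.  Finally ln n <= 3 * B,
    hence the term Delta * ln n costs only a constant factor.

    Instead of a coupling with exponential clocks, the comparison of speeds is
    made by a function of the current tree.  If the foremost layer reached is f
    and spoke j contains c_j vertices of the tree, the weight
       sum_j (3/2)^(c_j - l) * (1 - 1/(2K))^(f - (K * B - 1))
    does not increase on average (spoke_potential_super): the gain of a factor
    3/2 along the single boundary edge into the spoke is paid for by the loss on
    the K edges that move the front.  The weight is at least 1 when the hub is
    reached, so after truncation (potential) it bounds the probability of
    failure by its value on the initial tree (superharmonic_tail), which is at
    most K / 4^B (wheel_height, failure_weight).  The hypothesis on D gives
    Delta^3 <= 2^B, whence K / 4^B <= 8 / n. *)

(** * Growing trees and superharmonic functions *)

Section GrowingTrees.
Variables (G : graph) (s : G).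
Implicit Types (t u : rtree G) (a : G * G).

(** The trees that the process can produce, with any number of edges. *)
Inductive grown : rtree G -> Prop :=
| grown0 : grown set0
| grownU t a : grown t -> a \in boundary s t -> grown (a |: t).

Definition tree_edge t : rel G := fun x y => (x, y) \in t.

Lemma boundaryP t a :
  reflect [/\ a.1 \in tree_vertices s t, a.2 \notin tree_vertices s t
            & adj a.1 a.2] (a \in boundary s t).
Proof. rewrite [X in reflect _ X]in_set; exact: and3P. Qed.

Lemma tree_vertices0 : tree_vertices s set0 = [set s].
Proof. by rewrite /tree_vertices imset0 setU0. Qed.

Lemma tree_verticesU t a :
  tree_vertices s (a |: t) = a.2 |: tree_vertices s t.
Proof. by rewrite /tree_vertices imsetU1 setUCA. Qed.

Lemma root_in_tree t : s \in tree_vertices s t.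
Proof. exact: setU11. Qed.

Lemma boundary_notin t a : a \in boundary s t -> a \notin t.
Proof.
case/boundaryP=> _ h _; apply: contra h => at_.
by apply/setU1P; right; apply/imsetP; exists a.
Qed.

Lemma grown_edge t (x y : G) : grown t -> (x, y) \in t ->
  [/\ x \in tree_vertices s t, y \in tree_vertices s t & adj x y].
Proof.
move=> gt; elim: gt x y => [|{}t a gt IH /boundaryP[a1 a2 adja]] x y.
  by rewrite inE.
rewrite tree_verticesU => /setU1P[Ea|/IH[xt yt ->]].
  move: Ea a1 a2 adja => <- /= a1 a2 adja.
  by split=> //; rewrite ?setU11 // setU1r.
by split=> //; apply: setU1r.
Qed.

Lemma grown_path t x : grown t -> x \in tree_vertices s t ->
  exists2 p, path (tree_edge t) s p & last s p = x.
Proof.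
move=> gt; elim: gt x => [|{}t a gt IH /boundaryP[a1 _ _]] x.
  by rewrite tree_vertices0 => /set1P->; exists [::].
have mono p : path (tree_edge t) s p -> path (tree_edge (a |: t)) s p.
  by apply: sub_path => y z; apply: setU1r.
rewrite tree_verticesU => /setU1P[->|/IH[p pp <-]]; last first.
  by exists p => //; apply: mono.
case: (IH _ a1) => p pp lp.
exists (rcons p a.2); last by rewrite last_rcons.
by rewrite rcons_path mono //= lp /tree_edge -surjective_pairing setU11.
Qed.

Lemma grown_card t : grown t -> #|tree_vertices s t| = #|t|.+1.
Proof.
elim=> [|{}t a gt IH ab]; first by rewrite tree_vertices0 cards1 cards0.
rewrite tree_verticesU [LHS]cardsU1 [in RHS]cardsU1 IH (boundary_notin ab).
by case/boundaryP: ab => _ -> _.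
Qed.

(** Acyclicity in a form that is easy to carry along the growth: a new vertex is
    ranked just above its parent. *)
Lemma grown_rank t : grown t ->
  exists d : G -> nat, forall x y, (x, y) \in t -> (d x < d y)%N.
Proof.
elim=> [|{}t a gt [d dP] /boundaryP[a1 a2 adja]].
  by exists (fun=> 0%N) => x y; rewrite inE.
exists (fun x => if x == a.2 then (d a.1).+1 else d x) => x y.
have neq x' : x' \in tree_vertices s t -> (x' == a.2) = false.
  by move=> xt; apply: contraNF a2 => /eqP<-.
case/setU1P=> [Ea|xyt].
  by rewrite -Ea /= in a1 neq *; rewrite eqxx neq.
by have [xt yt _] := grown_edge gt xyt; rewrite !neq // dP.
Qed.

(** The rank increases along the path, so the path does not repeat a vertex. *)
Lemma grown_path_size t p : grown t -> path (tree_edge t) s p ->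
  (size p < #|G|)%N.
Proof.
move=> gt pp; have [d dP] := grown_rank gt.
have Us : uniq (s :: p).
  apply: (@map_uniq _ _ d); apply: (sorted_uniq ltn_trans ltnn).
  rewrite /= path_map; apply: sub_path pp => x y; exact: dP.
by rewrite -ltnS; move/card_uniqP: Us => /= <-; rewrite ltnS max_card.
Qed.

(** A path from the root can be prolonged until it ends in a leaf, because its
    length stays below the number of vertices. *)
Lemma path_le_height t p : grown t -> path (tree_edge t) s p ->
  (size p <= height s t)%N.
Proof.
move=> gt; have [m] := ubnP (#|G| - size p).
elim: m p => // m IH p mP pp.
have ltpG := grown_path_size gt pp.
have [lf|] := boolP (is_leaf t (last s p)).
  apply: (@bigop.bigmax_sup _ (Ordinal ltpG)) => //.
  by apply/existsP; exists (in_tuple p); rewrite lf andbT.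
rewrite negb_forall => /existsP[y]; rewrite negbK => yt.
apply: leq_trans (IH (rcons p y) _ _); rewrite ?size_rcons //.
  by rewrite -ltnS; apply: leq_trans mP; rewrite ltnS ltn_sub2l.
by rewrite rcons_path pp.
Qed.

Lemma height_path t : exists2 p, path (tree_edge t) s p & size p = height s t.
Proof.
rewrite /height; elim/big_ind: _ => [|m k [p pp <-] [q qp <-]|k].
- by exists [::].
- by rewrite /maxn; case: ltnP => _; [exists q|exists p].
by case/existsP=> p /andP[pp _]; exists p; rewrite ?size_tuple.
Qed.

Lemma height_grow t a : grown t -> a \in boundary s t ->
  (height s t <= height s (a |: t))%N.
Proof.
move=> gt ab; have [p pp <-] := height_path t.
apply: path_le_height; first exact: grownU.
by apply: sub_path pp => x y; apply: setU1r.
Qed.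

(** This is where connectedness is used: without a boundary edge the vertices of
    the tree are closed under adjacency. *)
Lemma boundary_neq0 t : (#|tree_vertices s t| < #|G|)%N ->
  boundary s t != set0.
Proof.
move=> ltV; apply/negP=> /eqP b0; move: ltV; apply/negP; rewrite -leqNgt.
have cl (x y : G) : adj x y -> x \in tree_vertices s t ->
    y \in tree_vertices s t.
  move=> xy xt; apply: contraT => yt; rewrite -(in_set0 (x, y)) -b0.
  by apply/boundaryP.
apply: subset_leq_card; apply/subsetP=> y _.
case/connectP: (adj_conn s y) => p pp ->.
elim/last_ind: p pp => [|p z IH]; first by rewrite root_in_tree.
by rewrite rcons_path last_rcons => /andP[/IH h /cl]; apply.
Qed.

Section Law.
Variable R : realType.
Implicit Types Phi : rtree G -> R.

Lemma tree_law_ge0 i t : 0 <= tree_law R s i t.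
Proof.
elim: i t => [|i IH] t /=; first by rewrite ler0n.
by apply: sumr_ge0 => u _; rewrite mulr_ge0 // divr_ge0 ?ler0n.
Qed.

(** Distinct boundary edges may be counted one by one: the mean of Phi after a
    step is its mean over the boundary edges. *)
Lemma step_prob_mean Phi u :
  \sum_t step_prob R s u t * Phi t
  = (\sum_(a in boundary s u) Phi (a |: u)) / #|boundary s u|%:R.
Proof.
rewrite mulr_suml.
under eq_bigr => t _.
  rewrite /step_prob -sum1_card natr_sum mulrAC mulr_suml mulr_suml.
  under eq_bigl => a do rewrite inE.
  rewrite big_mkcondr; over.
rewrite exchange_big /=; apply: eq_bigr => a _.
by rewrite -big_mkcond (big_pred1 (a |: u)) ?mul1r // => t; rewrite eq_sym.
Qed.

Lemma tree_lawS_mean Phi i :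
  \sum_t tree_law R s i.+1 t * Phi t
  = \sum_u tree_law R s i u *
      ((\sum_(a in boundary s u) Phi (a |: u)) / #|boundary s u|%:R).
Proof.
under eq_bigr => t _ do rewrite /= mulr_suml.
rewrite exchange_big /=; apply: eq_bigr => u _.
by rewrite -step_prob_mean mulr_sumr; apply: eq_bigr => t _; rewrite mulrA.
Qed.

Lemma tree_law_grown i t : tree_law R s i t != 0 -> grown t /\ #|t| = i.
Proof.
elim: i t => [|i IH] t /=.
  have [->|] := eqVneq t set0; last by rewrite eqxx.
  by rewrite cards0; split=> //; exact: grown0.
case: (boolP [exists u, tree_law R s i u * step_prob R s u t != 0]); last first.
  rewrite negb_exists => /forallP no; rewrite big1 ?eqxx // => u _.
  by apply/eqP; move: (no u); rewrite negbK.
case/existsP=> u; rewrite mulf_eq0 negb_or => /andP[/IH[gu <-] st] _.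
case: (set_0Vmem [set a in boundary s u | t == a |: u]) => [e0|[a]].
  by move: st; rewrite /step_prob e0 cards0 mul0r eqxx.
rewrite in_set => /andP[ab /eqP->]; split; first exact: grownU.
by rewrite cardsU1 boundary_notin.
Qed.

Lemma tree_law_sum1 i : (i < #|G|)%N -> \sum_t tree_law R s i t = 1.
Proof.
elim: i => [_|i IH ltiG].
  by rewrite (bigD1 set0) //= eqxx big1 ?addr0 // => t /negPf t0; rewrite /= t0.
under eq_bigr => t _ do rewrite -[tree_law _ _ _ _]mulr1.
rewrite (tree_lawS_mean (fun=> 1)) -[RHS](IH (ltnW ltiG)).
apply: eq_bigr => u _; have [->|/tree_law_grown[gu cu]] := eqVneq (tree_law R s i u) 0.
  by rewrite mul0r.
have b0 : boundary s u != set0 by apply: boundary_neq0; rewrite grown_card ?cu.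
by rewrite sumr_const divff ?mulr1 // pnatr_eq0 cards_eq0.
Qed.

Lemma tree_law_spanning t : tree_law R s #|G|.-1 t != 0 ->
  grown t /\ tree_vertices s t = setT.
Proof.
case/tree_law_grown=> gt ct; split=> //; apply/eqP.
have G0 : (0 < #|G|)%N by apply/card_gt0P; exists s.
by rewrite eqEcard subsetT cardsT grown_card // ct prednK /=.
Qed.

(** The averaging condition is multiplied by the size of the boundary, which
    makes it meaningful for spanning trees as well. *)
Definition superharmonic Phi := forall u, grown u ->
  0 <= Phi u /\
  \sum_(a in boundary s u) Phi (a |: u) <= #|boundary s u|%:R * Phi u.

Lemma superharmonic_mean Phi i : superharmonic Phi ->
  \sum_t tree_law R s i t * Phi t <= Phi set0.
Proof.
move=> sP; elim: i => [|i IH].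
  rewrite (bigD1 set0) //= eqxx mul1r big1 ?addr0 // => t /negPf t0; rewrite /= t0.
  by rewrite mul0r.
rewrite tree_lawS_mean; apply: le_trans IH; apply: ler_sum => u _.
have [->|/tree_law_grown[gu _]] := eqVneq (tree_law R s i u) 0.
  by rewrite !mul0r.
case: (sP u gu) => Phi0 sPu; apply: ler_wpM2l; first exact: tree_law_ge0.
have [c0|b0] := eqVneq #|boundary s u| 0%N.
  by rewrite c0 invr0 mulr0.
by rewrite ler_pdivrMr ?ltr0n ?lt0n // mulrC.
Qed.

(** Markov's inequality for the value of Phi on the final tree, whose mean is at
    most Phi set0. *)
Lemma superharmonic_tail Phi (E : pred (rtree G)) : superharmonic Phi ->
  (forall t, grown t -> tree_vertices s t = setT -> ~~ E t -> 1 <= Phi t) ->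
  1 - Phi set0 <= spanning_tree_Pr R s E.
Proof.
move=> sP badP; have G0 : (0 < #|G|)%N by apply/card_gt0P; exists s.
have := @tree_law_sum1 #|G|.-1; rewrite prednK // => /(_ (leqnn _)).
rewrite (bigID E) /= -/(spanning_tree_Pr R s E) => <-.
rewrite lerBlDr lerD2l; apply: le_trans (superharmonic_mean #|G|.-1 sP).
rewrite [leRHS](bigID E) /= -[leLHS]add0r; apply: lerD.
  apply: sumr_ge0 => t _.
  have [->|/tree_law_spanning[gt _]] := eqVneq (tree_law R s #|G|.-1 t) 0.
    by rewrite mul0r.
  by rewrite mulr_ge0 ?tree_law_ge0 //; case: (sP t gt).
apply: ler_sum => t Et.
have [->|/tree_law_spanning[gt sp]] := eqVneq (tree_law R s #|G|.-1 t) 0.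
  by rewrite mul0r.
by rewrite ler_peMr ?tree_law_ge0 // badP.
Qed.

End Law.
End GrowingTrees.

(** * The wheel graph *)

Section Distances.
Local Open Scope nat_scope.

Lemma dist_le (G : graph) (x y : G) p :
  path (@adj G) x p -> last x p = y -> dist x y <= size p.
Proof.
move=> pp lp; rewrite leqNgt; apply/negP => lt_p.
have := before_find 0 lt_p.
have lt_pG : size p < #|G|.
  by apply: leq_trans lt_p _; rewrite /dist -[leqRHS](size_iota 0) find_size.
rewrite nth_iota // add0n => /negbT/negP; apply.
by apply/existsP; exists (in_tuple p); rewrite pp lp eqxx.
Qed.

(** A height function with a descending edge at every vertex other than h yields
    paths to h; this gives connectedness and the diameter at once. *)
Lemma descending_path (V : finType) (e : rel V) (h : V) (d : V -> nat) :
  (forall x, x != h -> exists2 y, e x y & d y < d x) ->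
  forall x, exists2 p, path e x p & last x p = h /\ size p <= d x.
Proof.
move=> desc x; have [m] := ubnP (d x); elim: m x => // m IH x dx.
have [->|/desc[y xy dyx]] := eqVneq x h; first by exists [::].
have [|p pp [lp sp]] := IH y; first by lia.
by exists (y :: p); rewrite /= ?xy //; split=> //; lia.
Qed.

Lemma descending_connect (V : finType) (e : rel V) (h : V) (d : V -> nat) :
  symmetric e ->
  (forall x, x != h -> exists2 y, e x y & d y < d x) ->
  forall x y, connect e x y.
Proof.
move=> se desc; have toh x : connect e x h.
  have [p pp [lp _]] := descending_path desc x.
  by apply/connectP; exists p.
by move=> x y; apply: connect_trans (toh x) _; rewrite (sym_connect_sym se).
Qed.

Lemma descending_diameter (G : graph) (h : G) (d : G -> nat) m :
  (forall x, x != h -> exists2 y, adj x y & d y < d x) ->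
  (forall x, d x <= m) -> diameter G <= m.*2.
Proof.
move=> desc dm; apply/bigmax_leqP => x _; apply/bigmax_leqP => y _.
have [p pp [lp sp]] := descending_path desc x.
have [q qq [lq sq]] := descending_path desc y.
apply: leq_trans (@dist_le _ _ _ (p ++ rev (belast y q)) _ _) _.
- rewrite cat_path pp lp -lq rev_path; apply: sub_path qq => u v.
  by rewrite adj_sym.
- rewrite last_cat lp -lq; case: q {qq lq sq} => //= z q.
  by rewrite rev_cons last_rcons.
rewrite size_cat size_rev size_belast -addnn.
by apply: leq_add; [apply: leq_trans sp _|apply: leq_trans sq _].
Qed.

End Distances.

Section Wheel.
Local Open Scope nat_scope.
Variables K B l : nat.
Hypotheses (K_gt0 : 0 < K) (B_gt2 : 2 < B) (l_gt0 : 0 < l).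

(** The vertices are those of the spine, given by layer and column, those of the
    spokes, given by spoke and position counted from the spine, and the hub. *)
Definition wheel_vertex := option ('I_(K * B) * 'I_K + 'I_K * 'I_l)%type.
Implicit Types x y : wheel_vertex.

(** The edges directed away from the first layer and towards the hub. *)
Definition arc x y : bool :=
  match x, y with
  | Some (inl (i, _)), Some (inl (i', _)) => i.+1 == i' :> nat
  | Some (inl (i, b)), Some (inr (j, k)) =>
      [&& i == j * B :> nat, b == 0 :> nat & k == 0 :> nat]
  | Some (inr (j, k)), Some (inr (j', k')) =>
      (j == j') && (k.+1 == k' :> nat)
  | Some (inr (j, k)), None => k.+1 == l
  | _, _ => false
  end.

Definition wheel_adj x y := arc x y || arc y x.

Lemma wheel_adj_sym : symmetric wheel_adj.
Proof. by move=> x y; rewrite /wheel_adj orbC. Qed.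

Lemma wheel_adj_irr : irreflexive wheel_adj.
Proof. by rewrite /wheel_adj => -[[[i b]|[j k]]|] //=; rewrite orbb; lia. Qed.

Lemma KB_gt0 : 0 < K * B.
Proof. by rewrite muln_gt0 K_gt0 (ltn_trans _ B_gt2). Qed.

Definition hub : wheel_vertex := None.
Definition spine i (lt_i : i < K * B) b : wheel_vertex := Some (inl (Ordinal lt_i, b)).
Definition spoke j k : wheel_vertex := Some (inr (j, k)).

(** A bound for the distance to the hub.  From a spine vertex one walks back to
    the closest port below.  A vertex in the layer of a port but in another
    column first moves to the next layer and back, hence the exceptional value
    3. *)
Definition hub_rank x : nat :=
  match x with
  | Some (inl (i, b)) =>
      l + (if (i %% B == 0) && (b != 0 :> nat) then 3 else (i %% B).+1)
  | Some (inr (_, k)) => l - k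
  | None => 0
  end.

Lemma hub_rank_le x : hub_rank x <= l + B.
Proof.
have B0 : 0 < B by lia.
by case: x => [[[i b]|[j k]]|] /=; [|lia|lia]; have := ltn_pmod i B0; case: ifP; lia.
Qed.

Lemma hub_rank_desc x : x != hub ->
  exists2 y, wheel_adj x y & hub_rank y < hub_rank x.
Proof.
have B0 : 0 < B by lia.
pose b0 : 'I_K := Ordinal K_gt0; pose k0 : 'I_l := Ordinal l_gt0.
case: x => [[[i b]|[j k]]|] // _; last first.
  have [ltk|gek] := ltnP k.+1 l; last first.
    by exists hub; rewrite /wheel_adj /=; have := ltn_ord k; lia.
  by exists (spoke j (Ordinal ltk)); rewrite /wheel_adj /= ?eqxx; lia.
have iE := divn_eq i B; have ltiB := ltn_pmod i B0.
have ltj : i %/ B < K by rewrite ltn_divLR.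
have le_i : (i %/ B).+1 * B <= K * B by rewrite leq_pmul2r.
have [r0|r0] := eqVneq (i %% B) 0; last first.
  have i_gt0 : 0 < i by rewrite lt0n; apply: contra_neq r0 => ->; rewrite mod0n.
  have lt_i : i.-1 < K * B by apply: leq_ltn_trans (leq_pred i) _.
  exists (spine lt_i b0); first by rewrite /wheel_adj /= prednK ?eqxx ?orbT.
  have -> : hub_rank (Some (inl (i, b))) = l + (i %% B).+1.
    by rewrite /= (negPf r0).
  have -> : hub_rank (spine lt_i b0) = l + (i %% B).
    rewrite /= andbF; have -> : i.-1 = i %/ B * B + (i %% B).-1 by lia.
    by rewrite modnMDl modn_small; lia.
  by rewrite ltn_add2l.
have [b_0|b_n0] := eqVneq (b : nat) 0.
  exists (spoke (Ordinal ltj) k0); last by rewrite /= r0 b_0 /= subn0; lia.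
  by rewrite /wheel_adj /= b_0 andbT [X in X == _]iE r0 addn0 eqxx.
have lt_i : i.+1 < K * B by lia.
exists (spine lt_i b0); first by rewrite /wheel_adj /= eqxx.
have i1 : i.+1 %% B = 1 by rewrite -addn1 -modnDml r0 modn_small //; lia.
by rewrite /= andbF r0 b_n0 i1 /=; lia.
Qed.

Definition wheel : graph :=
  Graph wheel_adj_sym wheel_adj_irr
    (descending_connect wheel_adj_sym hub_rank_desc).

Lemma wheel_diameter : diameter wheel <= (l + B).*2.
Proof. exact: (@descending_diameter wheel hub hub_rank _ hub_rank_desc hub_rank_le). Qed.

Lemma wheel_card : #|wheel| = K * B * K + K * l + 1.
Proof. by rewrite card_option card_sum !card_prod !card_ord addn1. Qed.

(** Forward (resp. backward) arcs at a spine vertex are told apart by the column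
    of their other end, with one more possible value for a spoke. *)
Definition column x : option 'I_K := if x is Some (inl (_, b)) then Some b else None.

Lemma degree_arcs (x : wheel) :
  degree x <= #|[set y | arc x y]| + #|[set y | arc y x]|.
Proof.
apply: leq_trans (leq_card_setU _ _); apply: subset_leq_card.
by apply/subsetP=> y; rewrite !inE.
Qed.

Lemma Some_ord_inj : injective (@Some 'I_K).
Proof. by move=> b c []. Qed.

Lemma out_spine_card i b :
  #|[set y | arc (Some (inl (i, b))) y]| <= K + [exists j : 'I_K, i == j * B :> nat].
Proof.
rewrite -(@card_in_imset _ _ column); last first.
  move=> [[[i1 b1]|[j1 k1]]|] [[[i2 b2]|[j2 k2]]|]; rewrite !inE //=.
    by move=> /eqP e1 /eqP e2 [->]; congr (Some (inl (_, _))); apply: ord_inj; lia.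
  move=> /and3P[/eqP e1 _ /eqP k10] /and3P[/eqP e2 _ /eqP k20] _.
  have jj : j1 * B = j2 * B by rewrite -e1 -e2.
  congr (Some (inr (_, _))); apply: ord_inj; last by rewrite k10.
  by apply/eqP; rewrite -(eqn_pmul2r (m := B)) ?jj //; lia.
case: existsP => [_|no].
  by apply: leq_trans (max_card _) _; rewrite card_option card_ord addn1.
rewrite addn0 -[leqRHS]card_ord -(card_imset _ Some_ord_inj).
apply: subset_leq_card; apply/subsetP=> y /imsetP[[[[i2 b2]|[j2 k2]]|]]; rewrite !inE //=.
  by move=> _ ->; apply: imset_f.
by case/andP=> ij _; case: no; exists j2.
Qed.

Lemma in_spine_card i b : #|[set y | arc y (Some (inl (i, b)))]| <= (0 < i) * K.
Proof.
case: posnP => [i0|i0].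
  rewrite leqn0 cards_eq0; apply/eqP/setP=> -[[[i1 b1]|[j1 k1]]|]; rewrite !inE //=.
  by rewrite i0.
rewrite mul1n -(@card_in_imset _ _ column); last first.
  move=> [[[i1 b1]|[j1 k1]]|] [[[i2 b2]|[j2 k2]]|]; rewrite !inE //=.
  by move=> /eqP e1 /eqP e2 [->]; congr (Some (inl (_, _))); apply: ord_inj; lia.
rewrite -[leqRHS]card_ord -(card_imset _ Some_ord_inj).
apply: subset_leq_card; apply/subsetP=> y /imsetP[[[[i2 b2]|[j2 k2]]|]]; rewrite !inE //=.
by move=> _ ->; apply: imset_f.
Qed.

(** A spine vertex has K neighbours on each side and possibly a spoke.  For
    K = 1 the graph is a path: the only port lies in the first layer, which has
    no predecessor.  This is what makes Delta = 2 possible. *)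
Lemma wheel_degree D : 1 < D -> K < D -> (K = 1) \/ (K.*2 < D) ->
  max_degree wheel <= D.
Proof.
move=> D1 KD KD2; apply/bigmax_leqP => x _.
apply: leq_trans (degree_arcs x) _.
case: x => [[[i b]|[j k]]|].
- apply: leq_trans (leq_add (out_spine_card i b) (in_spine_card i b)) _.
  case: KD2 => [K1|K2]; last by case: (0 < i); case: [exists _, _]; lia.
  case: posnP => [_|i0]; first by case: [exists _, _]; lia.
  case: existsP => [[j /eqP ij]|_]; last lia.
  by have := ltn_ord j; lia.
- apply: (@leq_trans 2) => //; apply: (@leq_add _ _ 1 1); apply/card_le1_eqP.
    move=> [[[i1 b1]|[j1 k1]]|] [[[i2 b2]|[j2 k2]]|]; rewrite !inE //=.
    + move=> /andP[/eqP<- /eqP e1] /andP[/eqP<- /eqP e2].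
      by congr (Some (inr (_, _))); apply: ord_inj; lia.
    + by have := ltn_ord k1; lia.
    + by have := ltn_ord k2; lia.
  move=> [[[i1 b1]|[j1 k1]]|] [[[i2 b2]|[j2 k2]]|]; rewrite !inE //=.
  + move=> /and3P[/eqP e1 /eqP b10 _] /and3P[/eqP e2 /eqP b20 _].
    by congr (Some (inl (_, _))); apply: ord_inj; lia.
  + lia.
  + lia.
  + move=> /andP[/eqP-> /eqP e1] /andP[/eqP-> /eqP e2].
    by congr (Some (inr (_, _))); apply: ord_inj; lia.
rewrite (_ : [set y | arc None y] = set0) ?cards0; last first.
  by apply/setP=> -[[[i1 b1]|[j1 k1]]|]; rewrite !inE.
pose f (y : wheel_vertex) := if y is Some (inr (j, _)) then Some j else None.
rewrite add0n -(@card_in_imset _ _ f); last first.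
  move=> [[[i1 b1]|[j1 k1]]|] [[[i2 b2]|[j2 k2]]|]; rewrite !inE //=.
  by move=> /eqP e1 /eqP e2 [->]; congr (Some (inr (_, _))); apply: ord_inj; lia.
apply: leq_trans (max_card _) _; rewrite card_option card_ord //.
Qed.

End Wheel.

(** * Growth in the wheel graph *)

Section WheelTrees.
Local Open Scope nat_scope.
Variables K B l : nat.
Hypotheses (K_gt0 : 0 < K) (B_gt2 : 2 < B) (l_gt0 : 0 < l).

Local Notation G := (wheel K_gt0 B_gt2 l_gt0).
Local Notation spoke := (@spoke K B l).
Local Notation hub := (@hub K B l).

Let b0 : 'I_K := Ordinal K_gt0.

Lemma port_subproof (j : 'I_K) : j * B < K * B.
Proof. by rewrite ltn_pmul2r //; lia. Qed.

Definition port j : G := spine l (port_subproof j) b0.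
Definition start : G := port b0.

Local Notation "V( t )" := (tree_vertices start t).

(** A vertex of a spoke is given the layer of the port, so that away from the
    hub the layer changes by at most one along an edge. *)
Definition layer (x : G) : nat :=
  match x with
  | Some (inl (i, _)) => i
  | Some (inr (j, _)) => j * B
  | None => 0
  end.

Lemma layer_start : layer start = 0.
Proof. by rewrite /= mul0n. Qed.

Lemma layer_lt x : layer x < K * B.
Proof.
case: x => [[[i b]|[j k]]|] /=; first exact: ltn_ord.
  exact: port_subproof.
by rewrite KB_gt0.
Qed.

Lemma layer_adj (x y : G) : adj x y -> x != hub -> y != hub ->
  layer y <= (layer x).+1.
Proof.
case: x y => [[[i b]|[j k]]|] [[[i' b']|[j' k']]|] //= + _ _;
  rewrite /wheel_adj /=; try lia.
by rewrite (eq_sym j' j); case: eqP => //= ->; rewrite leqnSn.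
Qed.

(** Without the hub there is no shortcut: the layer grows by at most one along
    each edge of the tree path from the start. *)
Lemma layer_le_height t x : grown start t -> hub \notin V(t) -> x \in V(t) ->
  layer x <= height start t.
Proof.
move=> gt hubt /(grown_path gt)[p pp <-] {x}.
apply: leq_trans (path_le_height gt pp).
elim/last_ind: p pp => [|p x IH]; first by rewrite /= mul0n.
rewrite rcons_path last_rcons size_rcons => /andP[/IH lp ex].
have [pt xt px] := grown_edge gt ex.
apply: leq_trans (layer_adj px _ _) _; rewrite ?ltnS //.
  by apply: contraNneq hubt => <-.
by apply: contraNneq hubt => <-.
Qed.

(** The neighbour of a spoke vertex on the side of the spine. *)
Definition inward (j : 'I_K) (k : 'I_l) : G :=
  if k == 0 :> nat then port j
  else spoke j (Ordinal (leq_ltn_trans (leq_pred k) (ltn_ord k))).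

Lemma adj_spoke (x : G) j k : adj x (spoke j k : G) ->
  [\/ x = inward j k, x = hub
    | exists2 k', x = spoke j k' & inward j k' = spoke j k].
Proof.
case: x => [[[i b]|[j' k']]|] /=; last by constructor 2.
  rewrite /wheel_adj /= orbF => /and3P[/eqP ij /eqP b_0 k_0]; constructor 1.
  by rewrite /inward k_0; congr (Some (inl (_, _))); apply: ord_inj.
rewrite /wheel_adj /= => /orP[] /andP[/eqP jj /eqP kk]; subst j'.
  constructor 1; rewrite /inward ifF; last by rewrite -kk.
  by congr (Some (inr (_, _))); apply: ord_inj; rewrite /= -kk.
constructor 3; exists k' => //; rewrite /inward ifF; last by rewrite -kk.
by congr (Some (inr (_, _))); apply: ord_inj; rewrite /= -kk.
Qed.

(** As long as the hub is missing, a spoke can be entered only from its port. *)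
Lemma inward_in_tree t j k : grown start t -> hub \notin V(t) ->
  (spoke j k : G) \in V(t) -> inward j k \in V(t).
Proof.
move=> gt; elim: gt j k => [|{}t a gt IH /boundaryP[a1 a2 aa]] j k.
  by rewrite tree_vertices0 => _ /set1P.
rewrite tree_verticesU => hubat.
have hubt : hub \notin V(t) by apply: contra hubat; exact: setU1r.
case/setU1P=> [Ea|st]; last by rewrite setU1r // IH.
rewrite -Ea in aa a2; apply: setU1r.
case: (adj_spoke aa) => [<-//|a1h|[k' a1k k'k]].
  by rewrite a1h (negPf hubt) in a1.
by rewrite a1k in a1; move: (IH _ _ hubt a1); rewrite k'k (negPf a2).
Qed.

Lemma spoke_downward t j (k k' : 'I_l) : grown start t -> hub \notin V(t) ->
  (spoke j k : G) \in V(t) -> k' <= k -> (spoke j k' : G) \in V(t).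
Proof.
move=> gt hubt; have [m] := ubnP (k : nat); elim: m k => // m IH k km st.
rewrite leq_eqVlt => /orP[/eqP/ord_inj->//|lt_k].
have := inward_in_tree gt hubt st; rewrite /inward gtn_eqF; last by lia.
by move/IH; apply=> /=; lia.
Qed.

Lemma port_in_tree t j k : grown start t -> hub \notin V(t) ->
  (spoke j k : G) \in V(t) -> port j \in V(t).
Proof.
move=> gt hubt st.
pose k0 := Ordinal l_gt0.
exact: inward_in_tree (spoke_downward (k' := k0) gt hubt st (leq0n k)).
Qed.

Definition into_spoke (j : 'I_K) (a : G * G) : bool :=
  if a.2 is Some (inr (j', _)) then j' == j else false.

(** The tree fills an initial segment of the spoke, so only the edge to the first
    missing vertex can be chosen. *)
Lemma into_spoke_le1 t j : grown start t -> hub \notin V(t) ->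
  #|[set a in boundary start t | into_spoke j a]| <= 1.
Proof.
move=> gt hubt; apply/card_le1_eqP => a a'.
have in_spoke c : c \in [set a in boundary start t | into_spoke j a] ->
    exists2 k, c = (inward j k, spoke j k : G) &
      inward j k \in V(t) /\ (spoke j k : G) \notin V(t).
  case/setIdP; case: c => c1 [[[i b]|[j' k]]|] // /boundaryP[/= c1t c2t cc] /eqP jj.
  subst j'; have c1E : c1 = inward j k.
    case: (adj_spoke cc) => [//|c1h|[k' c1k k'k]].
      by rewrite c1h (negPf hubt) in c1t.
    rewrite c1k in c1t; move: (inward_in_tree gt hubt c1t).
    by rewrite k'k (negPf c2t).
  by exists k; rewrite -c1E.
move=> /in_spoke[k -> [ik sk]] /in_spoke[k' -> [ik' sk']].
wlog lt_k : k k' ik sk ik' sk' / k < k'.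
  move=> H; have [kk|kk|/ord_inj->//] := ltngtP k k'; first exact: H.
  by apply/esym; apply: H.
case/negP: sk; move: ik'; rewrite /inward gtn_eqF; last by lia.
by move=> ik'; apply: spoke_downward ik' _ => //=; lia.
Qed.

Definition front (t : rtree G) : nat := \max_(x in V(t)) layer x.

Lemma front_lt t : front t < K * B.
Proof.
rewrite -[K * B]prednK ?KB_gt0 // ltnS; apply/bigmax_leqP => x _.
by rewrite -ltnS prednK ?KB_gt0 // layer_lt.
Qed.

(** The front is attained in the spine, because a spoke vertex comes with its
    port. *)
Lemma front_spine t : grown start t -> hub \notin V(t) ->
  exists i b, (Some (inl (i, b)) : G) \in V(t) /\ i = front t :> nat.
Proof.
move=> gt hubt.
have V0 : 0 < #|V(t)| by apply/card_gt0P; exists start; apply: root_in_tree.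
have [[[[i b]|[j k]]|] xt fE] := eq_bigmax_cond layer V0.
- by exists i, b; rewrite /front fE.
- exists (Ordinal (port_subproof j)), b0; rewrite /front fE; split=> //.
  exact: port_in_tree xt.
by rewrite (negPf hubt) in xt.
Qed.

Definition advancing t (a : G * G) : bool :=
  if a.2 is Some (inl (i, _)) then i == (front t).+1 :> nat else false.

(** Nothing beyond the front is in the tree, so the K edges from a foremost spine
    vertex to the next layer all belong to the boundary. *)
Lemma advancing_ge t : grown start t -> hub \notin V(t) ->
  (front t).+1 < K * B ->
  K <= #|[set a in boundary start t | advancing t a]|.
Proof.
move=> gt hubt ltf; have [i [b [it ifr]]] := front_spine gt hubt.
pose f b' : G * G := (Some (inl (i, b)), spine l ltf b').
have f_inj : injective f by move=> b1 b2 [].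
rewrite -[X in X <= _]card_ord -(card_imset _ f_inj).
apply: subset_leq_card; apply/subsetP=> a /imsetP[b' _ ->].
apply/setIdP; split; last by rewrite /advancing /= eqxx.
apply/boundaryP; split=> //=; last by rewrite /wheel_adj /= ifr eqxx.
apply/negP => yt; have := @leq_bigmax_cond G (fun x => x \in V(t)) layer _ yt.
by rewrite -/(front t) /= ltnn.
Qed.

Definition progress t (j : 'I_K) : nat := #|[set k | (spoke j k : G) \in V(t)]|.

Lemma progress_grow t a j : a \in boundary start t ->
  progress (a |: t) j = progress t j + into_spoke j a.
Proof.
case: a => a1 a2 /boundaryP[/= _ a2t _]; rewrite /progress tree_verticesU /=.
rewrite /into_spoke /=.
have other : (forall k, spoke j k <> a2) ->
    #|[set k | (spoke j k : G) \in a2 |: V(t)]|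
    = #|[set k | (spoke j k : G) \in V(t)]|.
  move=> neq; apply: eq_card => k; rewrite [LHS]in_set [RHS]in_set in_setU1.
  by case: eqP => // /neq.
case: a2 a2t other => [[[i b]|[j' k]]|] a2t other; try by rewrite other ?addn0.
have [jj|jj] := eqVneq j' j; last first.
  by rewrite addn0 other // => k' [E]; rewrite E eqxx in jj.
subst j'; rewrite (_ : [set _ | _] = k |: [set k | (spoke j k : G) \in V(t)]).
  by rewrite cardsU1 inE a2t addnC.
apply/setP=> k'; rewrite [LHS]in_set [RHS]in_setU1 [X in _ = _ || X]in_set in_setU1.
by congr (_ || _); apply/eqP/eqP => [[]|->].
Qed.

Lemma front_grow t a : a \in boundary start t ->
  front t + advancing t a <= front (a |: t).
Proof.
move=> ab; rewrite /advancing.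
have le_f : front t <= front (a |: t).
  apply/bigmax_leqP => x xt; apply: (@leq_bigmax_cond G (fun y => y \in _) layer).
  by rewrite tree_verticesU setU1r.
case E: a.2 => [[[i b]|[j k]]|]; rewrite ?addn0 //.
case: eqP => [ifr|_]; rewrite ?addn0 // addn1 -ifr.
rewrite -[nat_of_ord i]/(layer (Some (inl (i, b)))) -E.
by apply: (@leq_bigmax_cond G (fun y => y \in _) layer); rewrite tree_verticesU setU11.
Qed.

Lemma progress_hub t a : grown start t -> hub \notin V(t) ->
  a \in boundary start t -> a.2 = hub -> exists j, progress t j = l.
Proof.
case: a => a1 a2 gt hubt /boundaryP[/= a1t _ +] Ea; rewrite Ea.
case: a1 a1t => [[[i b]|[j k]]|] // a1t; rewrite /= /wheel_adj /= ?orbF // => /eqP kl.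
exists j; rewrite /progress -[RHS]card_ord -cardsT; apply: eq_card => k'.
by rewrite in_set in_setT; apply: spoke_downward a1t _ => //; have := ltn_ord k'; lia.
Qed.

Section Potential.
Variable R : realType.
Local Open Scope ring_scope.

(* The choice of A and b is dictated by A - 1 = K * (1 - b). *)
Let A : R := 3 / 2.
Let b : R := 1 - (K.*2%:R)^-1.
Let scale : R := A ^+ l * b ^+ (K * B).-1.

Let three_halves : 3 / 2 = 1 + 2^-1 :> R.
Proof. by lra. Qed.

Let A_gt0 : 0 < A.
Proof. by rewrite /A; lra. Qed.

Let A_ge0 n : 0 <= A ^+ n.
Proof. by rewrite exprn_ge0 // ltW. Qed.

Let b_gt0 : 0 < b.
Proof.
by rewrite subr_gt0 invf_lt1 ?ltr0n ?ltr1n; lia.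
Qed.

Let b_le1 : b <= 1.
Proof. by rewrite lerBlDr lerDl invr_ge0 ler0n. Qed.

Let scale_gt0 : 0 < scale.
Proof. by rewrite mulr_gt0 ?exprn_gt0. Qed.

Definition spoke_potential t j : R := A ^+ progress t j * b ^+ front t / scale.

(** The truncation makes stopping times superfluous.  A tall tree stays tall, and
    once the hub is reached by a tree that is not tall, failure is counted with
    weight 1. *)
Definition potential t : R :=
  if ((K * B).-1 <= height start t)%N then 0
  else if hub \in V(t) then 1 else \sum_j spoke_potential t j.

Lemma spoke_potential_ge0 t j : 0 <= spoke_potential t j.
Proof. by rewrite ltW // divr_gt0 // mulr_gt0 ?exprn_gt0. Qed.

Lemma potential_ge0 t : 0 <= potential t.
Proof.
rewrite /potential; case: ifP => // _; case: ifP => // _.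
by apply: sumr_ge0 => j _; apply: spoke_potential_ge0.
Qed.

(** A new edge cannot both enter a spoke and advance in the spine, so the two
    effects on the product may be added. *)
Lemma spoke_potential_grow t a j : a \in boundary start t ->
  spoke_potential (a |: t) j <=
  spoke_potential t j *
    (1 + 2^-1 * (into_spoke j a)%:R - (K.*2%:R)^-1 * (advancing t a)%:R).
Proof.
move=> ab; rewrite /spoke_potential [leRHS]mulrAC.
rewrite ler_pM2r ?invr_gt0 //.
have bf : b ^+ front (a |: t) <= b ^+ (front t + advancing t a).
  by apply: ler_wiXn2l (front_grow ab); rewrite ?b_le1 // ltW.
apply: le_trans (ler_wpM2l (A_ge0 _) bf) _.
rewrite progress_grow // !exprD mulrACA ler_wpM2l //.
  by rewrite mulr_ge0 // exprn_ge0 // ltW.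
rewrite /into_spoke /advancing; case: a.2 => [[[i b']|[j' k]]|] /=.
- case: eqP => _; rewrite !expr0 ?expr1 /b ?mulr0 ?mulr1 ?mul1r ?addr0 ?subr0 //.
- case: eqP => _; rewrite !expr0 ?expr1 /A ?mulr0 ?mulr1 ?mul1r ?addr0 ?subr0 //.
  by rewrite three_halves.
by rewrite !mulr0 subr0 addr0 mulr1.
Qed.

(** At most one boundary edge gains the proportion 1/2, while at least K of them
    lose the proportion 1/(2K). *)
Lemma spoke_potential_super t j : grown start t -> hub \notin V(t) ->
  ((front t).+1 < K * B)%N ->
  \sum_(a in boundary start t) spoke_potential (a |: t) j
    <= #|boundary start t|%:R * spoke_potential t j.
Proof.
move=> gt hubt ltf.
apply: (@le_trans _ _ (\sum_(a in boundary start t) spoke_potential t j *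
    (1 + 2^-1 * (into_spoke j a)%:R - (K.*2%:R)^-1 * (advancing t a)%:R))).
  by apply: ler_sum => a; exact: spoke_potential_grow.
rewrite -mulr_sumr mulrC ler_wpM2r ?spoke_potential_ge0 //.
rewrite big_split big_split /= sumrN -!mulr_sumr sumr_const.
have count (P : pred (G * G)) :
    \sum_(a in boundary start t) (P a)%:R = #|[set a in boundary start t | P a]|%:R :> R.
  rewrite -sum1_card natr_sum [RHS](eq_bigl (fun a => (a \in boundary start t) && P a)).
    by rewrite [RHS]big_mkcondr; apply: eq_bigr => a _; case: (P a).
  by move=> a; rewrite inE.
rewrite !count.
have := into_spoke_le1 j gt hubt; have := advancing_ge gt hubt ltf.
set m := #|_|; set n := #|[set a in _ | into_spoke j a]|.
rewrite -(ler_nat R) -(ler_nat R n) => Km n1.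
have : 2^-1 <= (K.*2%:R)^-1 * m%:R :> R.
  by rewrite mulrC ler_pdivlMr ?ltr0n ?double_gt0 // -muln2 natrM mulrCA mulVf ?mulr1 // pnatr_eq0.
move=> Km2; rewrite -addrA gerDl subr_le0; apply: le_trans Km2.
by rewrite ler_piMr // invr_ge0 ler0n.
Qed.

(** The spoke through which the hub is reached is full. *)
Lemma hub_spoke_potential t a : grown start t -> hub \notin V(t) ->
  a \in boundary start t -> a.2 = hub ->
  1 <= \sum_j spoke_potential (a |: t) j.
Proof.
move=> gt hubt ab ah; have [j pj] := progress_hub gt hubt ab ah.
rewrite (bigD1 j) //= -[leLHS]addr0; apply: lerD; last first.
  by apply: sumr_ge0 => i _; apply: spoke_potential_ge0.
rewrite /spoke_potential ler_pdivlMr // mul1r.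
rewrite progress_grow // pj /into_spoke ah addn0.
rewrite ler_wpM2l //.
apply: ler_wiXn2l; rewrite ?b_le1 ?(ltW b_gt0) //.
by rewrite -ltnS prednK ?KB_gt0 // front_lt.
Qed.

Lemma potential_super : superharmonic start potential.
Proof.
move=> t gt; split; first exact: potential_ge0.
rewrite {2}/potential; case: ifP => [tall|short].
  rewrite mulr0 big1 // => a ab; rewrite /potential.
  by rewrite (leq_trans tall (height_grow gt ab)).
case: ifP => [hubt|/negbT hubt].
  rewrite mulr1 -sumr_const; apply: ler_sum => a ab; rewrite /potential.
  by case: ifP => // _; rewrite tree_verticesU setU1r.
have ltf : ((front t).+1 < K * B)%N.
  have [i [c [it <-]]] := front_spine gt hubt.
  have := layer_le_height gt hubt it; move: short => /= /negbT.
  by rewrite -ltnNge => /[swap] /leq_ltn_trans/[apply]; lia.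
rewrite mulr_sumr.
apply: (@le_trans _ _
    (\sum_j \sum_(a in boundary start t) spoke_potential (a |: t) j)); last first.
  by apply: ler_sum => j _; exact: spoke_potential_super.
rewrite exchange_big /=; apply: ler_sum => a ab; rewrite /potential.
case: ifP => _; first by apply: sumr_ge0 => j _; apply: spoke_potential_ge0.
case: ifP => [|_ //]; rewrite tree_verticesU => /setU1P[/esym ha|].
  exact: hub_spoke_potential.
by rewrite (negPf hubt).
Qed.

Lemma progress0 j : progress set0 j = 0%N.
Proof.
apply: eq_card0 => k; rewrite in_set tree_vertices0 in_set1.
by apply/negbTE/eqP.
Qed.

(** A spanning tree contains the hub, so its potential is 1 unless it is tall. *)
Theorem wheel_height :
  1 - K%:R / ((3 / 2) ^+ l * (1 - (K.*2%:R)^-1) ^+ (K * B)) <=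
  spanning_tree_Pr R start (fun t => (K * B).-1 <= height start t)%N.
Proof.
rewrite -/b -/A.
apply: le_trans (superharmonic_tail potential_super _); last first.
  move=> t gt sp /negbTE short; rewrite /potential short sp inE; exact: lexx.
rewrite lerD2l lerN2 /potential.
have bound : 1 / scale <= 1 / (A ^+ l * b ^+ (K * B)).
  rewrite !mul1r lef_pV2 ?posrE //; last first.
    by rewrite mulr_gt0 ?exprn_gt0.
  rewrite ler_wpM2l //.
  by apply: ler_wiXn2l; rewrite ?b_le1 ?(ltW b_gt0) // leq_pred.
have pos : 0 <= K%:R / (A ^+ l * b ^+ (K * B)).
  by rewrite divr_ge0 // mulr_ge0 // exprn_ge0 // ltW.
case: ifP => // _; case: ifP => [|_]; first by rewrite tree_vertices0 in_set1 => /eqP.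
apply: (@le_trans _ _ (\sum_(j < K) 1 / (A ^+ l * b ^+ (K * B)))).
  apply: ler_sum => j _; apply: le_trans bound; rewrite /spoke_potential progress0.
  rewrite ler_pM2r ?invr_gt0 // mul1r exprn_ile1 ?b_le1 ?(ltW b_gt0) //.
by rewrite sumr_const card_ord -[leLHS]mulr_natl mul1r.
Qed.

End Potential.

End WheelTrees.

(** * Choice of the parameters *)

From mathcomp Require Import all_classical all_reals all_analysis.
Import numFieldNormedType.Exports.

Section Estimates.
Variable R : realType.

Lemma bernoulli_ge (x : R) n : 0 <= x -> x <= 1 -> 1 - n%:R * x <= (1 - x) ^+ n.
Proof.
move=> x0 x1; elim: n => [|n IH]; first by rewrite mul0r subr0 expr0.
rewrite exprS -natr1; apply: le_trans (ler_wpM2l _ IH); last by rewrite subr_ge0.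
rewrite -subr_ge0.
have -> : (1 - x) * (1 - n%:R * x) - (1 - (n%:R + 1) * x) = n%:R * x ^+ 2 by ring.
by rewrite mulr_ge0 ?sqr_ge0.
Qed.

(** By Bernoulli's inequality K layers cost at most a factor 2, whereas 6 spoke
    vertices are worth (3/2)^6 > 8. *)
Lemma failure_weight K B : (0 < K)%N ->
  4 ^+ B <= (3 / 2) ^+ (6 * B) * (1 - (K.*2%:R)^-1) ^+ (K * B) :> R.
Proof.
move=> K0; rewrite !exprM -exprMn; apply: lerXn2r; rewrite ?nnegrE //.
  rewrite mulr_ge0 // exprn_ge0 ?divr_ge0 // subr_ge0 invf_le1 ?ltr0n ?ler1n ?double_gt0 //.
have h : 2^-1 <= (1 - (K.*2%:R)^-1) ^+ K :> R.
  apply: le_trans (bernoulli_ge K _ _); rewrite ?invr_ge0 //; last first.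
    by rewrite invf_le1 ?ltr0n ?ler1n ?double_gt0.
  rewrite -muln2 natrM invfM mulrA divff ?pnatr_eq0 -?lt0n // mul1r; lra.
apply: (@le_trans _ _ ((3 / 2) ^+ 6 * 2^-1)); last first.
  by rewrite ler_wpM2l // exprn_ge0 // divr_ge0.
rewrite !exprS expr0; lra.
Qed.

Lemma ln2_ge : 2^-1 <= ln 2 :> R.
Proof.
have e : expR 2^-1 <= 2 :> R.
  have := expR_ge1Dx (- 2^-1 : R); rewrite expRN => h.
  rewrite -[leLHS]invrK -[leRHS]invrK lef_pV2 ?posrE ?invr_gt0 ?expR_gt0 //.
  by apply: le_trans h; lra.
by rewrite -[leLHS]expRK ler_ln ?posrE ?expR_gt0.
Qed.

Lemma ln2_le : ln 2 <= 1 :> R.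
Proof. by apply: (@le_ln1Dx R 1); lra. Qed.

Lemma ln_degree_le (Delta D : nat) :
  16 * expR 1 ^+ 3 * ln Delta%:R <= D%:R :> R -> (1 < Delta)%N ->
  128 * ln Delta%:R <= D%:R :> R.
Proof.
move=> h D1; apply: le_trans h; rewrite ler_wpM2r ?ln_ge0 ?ler1n ?(ltnW D1) //.
have e2 : 2 <= expR 1 :> R by have := expR_ge1Dx (1 : R); lra.
have : 2 ^+ 3 <= expR 1 ^+ 3 :> R by rewrite lerXn2r ?nnegrE ?expR_ge0.
by rewrite [2 ^+ 3]exprS; lra.
Qed.

Lemma diameter_large (Delta D : nat) : (1 < Delta)%N ->
  128 * ln Delta%:R <= D%:R :> R -> (64 <= D)%N.
Proof.
move=> D1 h; rewrite -(ler_nat R); apply: le_trans h.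
have : ln 2 <= ln Delta%:R :> R by rewrite ler_ln ?posrE ?ltr0n ?ler_nat // ltnW.
have := ln2_ge; lra.
Qed.

(** As ln 2 >= 1/2, it suffices that 3 * 18 / 128 <= 1/2. *)
Lemma degree_pow (Delta D B : nat) : (1 < Delta)%N -> (D <= 18 * B)%N ->
  128 * ln Delta%:R <= D%:R :> R -> (Delta ^ 3 <= 2 ^ B)%N.
Proof.
move=> D1 DB h; rewrite -(ler_nat R) !natrX.
have D0 : 0 < Delta%:R :> R by rewrite ltr0n ltnW.
rewrite -ler_ln ?posrE ?exprn_gt0 // !lnXn // -[leLHS]mulr_natr -[leRHS]mulr_natr.
have : D%:R <= 18 * B%:R :> R by rewrite -natrM ler_nat.
have B0 : 0 <= B%:R :> R by [].
have := ler_wpM2r B0 ln2_ge; lra.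
Qed.

Lemma spanning_tree_Pr_le (G : graph) (s : G) (E E' : pred (rtree G)) :
  (forall t, E t -> E' t) -> spanning_tree_Pr R s E <= spanning_tree_Pr R s E'.
Proof.
move=> sub; rewrite /spanning_tree_Pr big_mkcond [leRHS]big_mkcond.
apply: ler_sum => t _; case: ifP => [/sub->//|_].
by case: ifP => // _; apply: tree_law_ge0.
Qed.

Lemma inv_cvg0 : (8 / x @[x --> +oo] --> (0 : R))%classic.
Proof.
rewrite -[X in (_ --> X)%classic](mulr0 8).
apply: cvgMr; apply/gtr0_cvgV0; last exact: cvg_id.
exact: nbhs_pinfty_gt.
Qed.

End Estimates.

Lemma divn14_cvg : ((D %/ 14)%N @[D --> \oo] --> \oo)%classic.
Proof.
apply/cvgnyPge => A; near=> D.
by rewrite leq_divRL //; near: D; exact: nbhs_infty_ge.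
Unshelve. all: by end_near. Qed.

Unset Implicit Arguments.
Set Strict Implicit.
Local Open Scope classical_set_scope.

Theorem theorem7 (R : realType) :
  exists c : R, 0 < c /\
  exists f : R -> R, f x @[x --> +oo] --> (0 : R) /\
  exists N : nat -> nat, N k @[k --> \oo] --> \oo /\
  forall Delta D : nat, (1 < Delta)%N -> (0 < D)%N ->
    16 * expR 1 ^+ 3 * ln Delta%:R <= D%:R :> R ->
    exists (G : graph) (s : G),
      let n := #|G| in
      [/\ (max_degree G <= Delta)%N,
          (diameter G <= D)%N,
          (N D <= n)%N
        & 1 - f n%:R <=
          spanning_tree_Pr R s
            (fun t => c * (Delta%:R * ln n%:R + Delta%:R * D%:R)
                      <= (height s t)%:R)].
Proof.
exists (168^-1); split; first by rewrite invr_gt0.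
exists (fun x => 8 / x); split; first exact: inv_cvg0.
exists (fun D => D %/ 14)%N; split; first exact: divn14_cvg.
move=> Delta D Delta1 D0 /ln_degree_le/(_ Delta1) hD.
have D64 := diameter_large Delta1 hD.
(* For Delta = 2 the quotient vanishes; with K = 1 the graph is then a path. *)
pose K := maxn 1 (Delta.-1 %/ 2); pose B := (D %/ 14)%N.
have B4 : (4 <= B)%N by rewrite leq_divRL; lia.
have DB : (D <= 18 * B)%N by rewrite /B; lia.
have D14 : (14 * B <= D)%N by rewrite /B; lia.
have K0 : (0 < K)%N by rewrite /K; lia.
have KDelta : (K < Delta)%N by rewrite /K; lia.
have K2 : K = 1%N \/ (K.*2 < Delta)%N by rewrite /K; lia.
have DeltaK : (Delta <= 4 * K)%N by rewrite /K; lia.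
have B2 : (2 < B)%N by lia.
have l0 : (0 < 6 * B)%N by lia.
clearbody K; clearbody B.
pose G := wheel K0 B2 l0; exists G, (start K0 B2 l0).
have nE : #|G| = (K * B * K + K * (6 * B) + 1)%N := wheel_card _ _ _.
have DeltaB := degree_pow Delta1 DB hD.
have K3 : (K ^ 3 <= 2 ^ B)%N by apply: leq_trans DeltaB; rewrite leq_exp2r // ltnW.
have B2B : (B <= 2 ^ B)%N by rewrite ltnW // ltn_expl.
(* Since n <= 8 * K^2 * B, this gives K / 4^B <= 8 / n. *)
have Kn : (K * #|G| <= 8 * 4 ^ B)%N.
  have -> : (4 ^ B = 2 ^ B * 2 ^ B)%N by rewrite -expnMn.
  apply: (@leq_trans (8 * (K ^ 3 * B))%N); last by rewrite leq_mul2l /= leq_mul.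
  rewrite nE !expnS expn0 muln1; nia.
have n0 : (0 < #|G|)%N by rewrite nE addn1.
split.
- exact: wheel_degree.
- by apply: leq_trans (wheel_diameter _ _ _) _; lia.
- by rewrite nE; nia.
apply: (@le_trans _ _ (spanning_tree_Pr R (start K0 B2 l0)
    (fun t => (K * B).-1 <= height (start K0 B2 l0) t)%N)); last first.
  apply: spanning_tree_Pr_le => t tall.
  apply: (@le_trans _ _ (K * B).-1%:R); last by rewrite ler_nat.
  have lnn : ln #|G|%:R <= 3 * B%:R :> R.
    have le_n : (#|G| <= 2 ^ (2 * B + 3))%N.
      by rewrite expnD expnM mulnC; apply: leq_trans Kn; nia.
    apply: (@le_trans _ _ (ln (2 ^+ (2 * B + 3)))).
      by rewrite ler_ln ?posrE ?exprn_gt0 ?ltr0n // -natrX ler_nat.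
    rewrite lnXn // -[leLHS]mulr_natr.
    apply: (@le_trans _ _ (1 * (2 * B + 3)%:R)); first by rewrite ler_wpM2r ?ln2_le.
    by rewrite mul1r -natrM ler_nat; lia.
  rewrite ler_pdivrMl // -mulrDr.
  apply: (@le_trans _ _ (Delta%:R * (3 * B%:R + 18 * B%:R))).
    by rewrite ler_wpM2l // lerD // -natrM ler_nat.
  rewrite -mulrDl -natrD -!natrM ler_nat.
  have KB : (K * B <= 2 * (K * B).-1)%N by nia.
  nia.
apply: le_trans (wheel_height K0 B2 l0 R).
rewrite lerD2l lerN2 ler_pdivrMr; last first.
  by apply: lt_le_trans (failure_weight _ _ K0); rewrite exprn_gt0.
rewrite mulrAC ler_pdivlMr ?ltr0n //.
apply: (@le_trans _ _ (8 * 4 ^+ B)).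
  by rewrite -natrX -!natrM ler_nat.
by rewrite ler_wpM2l // failure_weight.
Qed.
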